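(* Let $d\ge 1$, $n\ge 1$, $a\ge 1$ and $b\ge 0$ be integers. Then $$\alpha^d\big(an-(a-1)-b\big)=\sum_{j\ge 0}\ \sum_{i=0}^{j}(-1)^i\binom{d+1}{i}\binom{d+a(j-i)-b}{a(j-i)-b}\,\alpha^d(n-j).$$
   Context: $\alpha^d(m)$ denotes the $m$-th $d$-dimensional simplex number: $\alpha^d(m)=\binom{m+d-1}{d}$ for integers $m\ge 1$, and $\alpha^d(m)=0$ for integers $m\le 0$. A binomial coefficient $\binom{p}{q}$ with $q<0$ is $0$. The sum over $j$ is finite because $\alpha^d(n-j)=0$ for $j\ge n$. *)

(* Defs.v *)
From mathcomp Require Import all_boot all_order all_algebra.
From mathcomp Require Import classical_sets fsbigop.

Set Implicit Arguments.
Unset Strict Implicit.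
Unset Printing Implicit Defensive.

Import Order.TTheory GRing.Theory Num.Theory.
Local Open Scope ring_scope.

(* p (p - 1) ... (p - q + 1) / q! for q >= 0, and 0 for q < 0; for a negative
   upper argument this is 'C(- n.+1, k) = (-1)^k 'C(n + k, k). *)
Definition binz (p q : int) : int :=
  match q, p with
  | Negz _, _ => 0
  | Posz k, Posz n => ('C(n, k))%:Z
  | Posz k, Negz n => (-1) ^+ k * ('C(n + k, k))%:Z
  end.

Definition simplex (d : nat) (m : int) : int :=
  if 1 <= m then binz (m + d%:Z - 1) d%:Z else 0.

Lemma simplex_eq0 (d : nat) (m : int) : m <= 0 -> simplex d m = 0.
Proof. by rewrite /simplex; case: ifP => // m1 m0; have := le_trans m1 m0. Qed.

(* The sum over [set: nat] has finite support, so the convention that \sum_(_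
   \in _) is 0 on families with infinite support never applies to it. *)
Lemma sum_simplex_fin (d n : nat) (F : nat -> nat -> int) :
  \sum_(j \in [set: nat]%classic)
    \sum_(0 <= i < j.+1) F i j * simplex d (n%:Z - j%:Z) =
  \sum_(0 <= j < n) \sum_(0 <= i < j.+1) F i j * simplex d (n%:Z - j%:Z).
Proof.
rewrite (@fsbigE _ _ _ _ _ (index_iota 0 n)) ?iota_uniq //.
- by apply: eq_bigl => j; rewrite in_setT.
- move=> j _; rewrite mem_index_iota /= -leqNgt => nj.
  by apply: big1 => i _; rewrite simplex_eq0 ?mulr0 // subr_le0.
Qed.

(* Main.v *)
Require Import Defs.
From mathcomp Require Import all_boot all_order all_algebra.
From mathcomp Require Import classical_sets fsbigop.
From mathcomp Require Import ring.

(** Put [h q := binz (d + q) q], so that [h] vanishes on negative integers and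
    [simplex d (q + 1) = h q] for every integer [q] ([simplex_succ]). With
    [H k := h (a k - b)] and [n = N + 1] the identity to prove reads
    [H N = \sum_j \sum_i (-1)^i 'C(d + 1, i) H (j - i) h (N - j)],
    and it holds for an arbitrary sequence [H] ([binomial_deconvolution]): the
    inner sum is a coefficient of [H(x) (1 - x)^(d+1)], the outer one convolves
    it with the coefficients [h k] of [(1 - x)^-(d+1)], and the two powers of
    [1 - x] cancel.

    The generating series are truncated to polynomials, which is harmless: the
    coefficients of a product up to some degree depend only on those of its
    factors up to the same degree. The series of [(1 - x)^-e] is recognised by
    Pascal's rule, since multiplying it by [1 - x] lowers [e] by one. *)

Import Order.TTheory GRing.Theory Num.Theory.
Local Open Scope ring_scope.

Lemma eq_coefM_low (R : nzRingType) (p q q' : {poly R}) (m : nat) :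
  (forall k, (k <= m)%N -> q`_k = q'`_k) -> (p * q)`_m = (p * q')`_m.
Proof. by move=> qq'; rewrite !coefM; apply: eq_bigr => i _; rewrite qq' ?leq_subr. Qed.

Lemma coef_exp_1subX (R : comNzRingType) (e i : nat) :
  ((1 - 'X : {poly R}) ^+ e)`_i = (-1) ^+ i * 'C(e, i)%:R.
Proof.
rewrite exprBn coef_sum.
under eq_bigr => k _.
  rewrite expr1n mulr1 -(rmorphN1 (@polyC R)) -rmorphXn coefMn coefCM coefXn.
  over.
have [ie | ei] := leqP i e; last first.
  rewrite bin_small // mulr0 big1 // => k _.
  by rewrite gtn_eqF ?mulr0 ?mul0rn // (leq_ltn_trans _ ei) // -ltnS.
rewrite (bigD1 (Ordinal (ie : (i < e.+1)%N))) //= eqxx mulr1 mulr_natr.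
by rewrite big1 ?addr0 // => k /negPf ki; rewrite eq_sym [_ == _]ki mulr0 mul0rn.
Qed.

Section BinomialSeries.

Variable R : comNzRingType.

(** The truncation at degree [n] of the series of [(1 - x)^-e]. For [e = 0] the
    truncated predecessor gives [1], as it should: ['C(k.-1, k) = (k == 0)]. *)
Definition negbin_poly (n e : nat) : {poly R} :=
  \poly_(k < n) 'C((k + e).-1, k)%:R.

Lemma coef_1subX_negbin n e m : (m < n)%N ->
  ((1 - 'X) * negbin_poly n e.+1)`_m = (negbin_poly n e)`_m.
Proof.
move=> mn; rewrite mulrBl mul1r coefB coefXM !coef_poly mn.
case: m mn => [|m] mn /=; first by rewrite !bin0 subr0.
by rewrite (ltnW mn) !addnS /= binS natrD addrK.
Qed.

Lemma coef_exp_1subX_negbin n e m : (m < n)%N ->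
  ((1 - 'X) ^+ e * negbin_poly n e)`_m = (m == 0)%:R.
Proof.
elim: e m => [|e IHe] m mn.
  rewrite expr0 mul1r coef_poly mn addn0.
  by case: m mn => [|m] _ //; rewrite bin_small.
rewrite exprSr -mulrA -(IHe m mn); apply: eq_coefM_low => k km.
by apply: coef_1subX_negbin; apply: leq_ltn_trans mn.
Qed.

(** Multiplying a power series by [(1 - x)^(d+1)] and then by its inverse gives
    the series back, read off in degree [N]. *)
Lemma binomial_deconvolution (d N : nat) (H : nat -> R) :
  H N = \sum_(0 <= j < N.+1) \sum_(0 <= i < j.+1)
          (-1) ^+ i * 'C(d.+1, i)%:R * H (j - i)%N * 'C(d + (N - j), N - j)%:R.
Proof.
pose P := \poly_(k < N.+1) H k; pose S := negbin_poly N.+1 d.+1.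
have -> : H N = ((1 - 'X) ^+ d.+1 * P * S)`_N.
  rewrite mulrAC mulrC (@eq_coefM_low _ _ _ 1) ?mulr1 ?coef_poly ?ltnSn //.
  by move=> k kN; rewrite coef1 coef_exp_1subX_negbin.
rewrite coefM big_mkord; apply: eq_bigr => j _.
rewrite coefM mulr_suml big_mkord; apply: eq_bigr => i _.
have jN : (j <= N)%N by rewrite -ltnS.
rewrite coef_exp_1subX !coef_poly !ltnS leq_subr.
by rewrite (leq_trans (leq_subr _ _) jN) addnS addnC.
Qed.

End BinomialSeries.

(** Both sides are the number of monomials of degree [q] in [d + 1] variables,
    and both conventions make it [0] for negative [q]. *)
Lemma simplex_succ (d : nat) (q : int) : simplex d (q + 1) = binz (d%:Z + q) q.
Proof.
case: q => k; last by rewrite simplex_eq0 //; case: k.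
rewrite /simplex lerDr lez_nat /= addrAC addrK -!PoszD /=.
by rewrite -bin_sub ?leq_addl // addnK addnC.
Qed.

Theorem theorem2 (d n a b : nat) (hd : (1 <= d)%N) (hn : (1 <= n)%N)
    (ha : (1 <= a)%N) :
  simplex d (a%:Z * n%:Z - (a%:Z - 1) - b%:Z) =
  \sum_(j \in [set: nat]%classic)
    \sum_(0 <= i < j.+1)
      (-1) ^+ i * ('C(d.+1, i))%:Z *
      binz (d%:Z + a%:Z * (j%:Z - i%:Z) - b%:Z)
           (a%:Z * (j%:Z - i%:Z) - b%:Z) *
      simplex d (n%:Z - j%:Z).
Proof.
rewrite sum_simplex_fin; case: n hn => // N _.
have -> : a%:Z * N.+1%:Z - (a%:Z - 1) - b%:Z = (a%:Z * N%:Z - b%:Z) + 1.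
  by rewrite -addn1 PoszD; ring.
rewrite simplex_succ.
rewrite (binomial_deconvolution _ d N
  (fun k => binz (d%:Z + (a%:Z * k%:Z - b%:Z)) (a%:Z * k%:Z - b%:Z))).
apply: eq_big_nat => j /andP[_ jN]; apply: eq_big_nat => i /andP[_ ij].
rewrite !natz subzn // addrA; congr (_ * _).
have -> : N.+1%:Z - j%:Z = (N - j)%N%:Z + 1.
  by rewrite -subzn // -addn1 PoszD; ring.
by rewrite simplex_succ -PoszD.
Qed.
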